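(* Let $A$ be an $N$-interior $p$-permutation $G$-algebra, where $N\trianglelefteq G$, and let $c$ be a primitive idempotent of $A^G$. Let $(Q,f_Q)$ be an $(A,c,G)$-Brauer pair such that $f_Q$ is primitive in $A(Q)^{C_N(Q)}$. Consider a subgroup $H$ of $G$ with $C_N(Q)\leq H\leq N_G(Q,f_Q)$ and a $p$-subgroup $S$ of $G$ such that $Q\leq S\leq H$. Let $f_S$ be a block of $A(S)$. The following are equivalent: (i) $(S,f_S)$ is an $(A,c,G)$-Brauer pair with $(Q,f_Q)\leq(S,f_S)$; (ii) $(S,f_S)$ is an $(A(Q),f_Q,H)$-Brauer pair.
   Context: $k$ is a field of prime characteristic $p$ (not necessarily algebraically closed), algebras are finite dimensional over $k$, $G$ is a finite group and $N\trianglelefteq G$ with $p$ dividing $|N|$. A $G$-algebra $A$ is a $k$-algebra on which $G$ acts by algebra automorphisms; it is a $p$-permutation $G$-algebra if for every $p$-subgroup $P$ of $G$ it has a $P$-stable $k$-basis. It is $N$-interior if it is equipped with a $G$-equivariant unital algebra homomorphism $kN\to A$ such that the action of $n\in N$ on $A$ is conjugation by the image of $n$. $A^L$ denotes the $L$-fixed elements and $A_K^L$ the image of the relative trace $\mathrm{Tr}_K^L:A^K\to A^L$. For a $p$-subgroup $Q$ of $G$, $A(Q)=A^Q/\sum_{R<Q}A_R^Q$ with quotient map $\mathrm{Br}_Q^A:A^Q\to A(Q)$; it is an $N_G(Q)$-algebra. For $Q\le S\le N_G(Q)$ one identifies $A(Q)(S)$ with $A(S)$ so that $\mathrm{Br}_S^{A(Q)}\circ\mathrm{Br}_Q^A=\mathrm{Br}_S^A$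 on $A^S$. A block is a primitive idempotent of the centre. $N_G(Q,f)$ is the stabilizer of $f\in A(Q)$ in $N_G(Q)$. For a $p$-permutation $G$-algebra $A$ and a primitive idempotent $c$ of $A^G$, an $(A,c,G)$-Brauer pair is a pair $(R,e)$ with $R$ a $p$-subgroup of $G$ and $e$ a block of $A(R)$ such that $\mathrm{Br}_R^A(c)e\neq 0$; $(R,e)\le(S,f)$ means $R\le S$ and for every primitive idempotent $i$ of $A^S$ with $\mathrm{Br}_S^A(i)f\neq0$ one has $\mathrm{Br}_R^A(i)e\ne0$. The same definition is applied to the triple $(A(Q),f_Q,H)$. *)

(* Defs.v *)
From mathcomp Require Import all_boot all_order all_algebra all_fingroup all_solvable.

Set Implicit Arguments.
Unset Strict Implicit.
Unset Printing Implicit Defensive.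

Import GRing.Theory.
Local Open Scope ring_scope.

Reserved Notation "x ** y" (at level 40, left associativity).

(* Finite dimensional unital associative algebras.  The zero algebra is
   allowed, unlike in algType and falgType, since A(Q) below may be zero. *)
Record fdalg (k : fieldType) := FdAlg {
  fd_vect :> vectType k;
  aone : fd_vect;
  amul : fd_vect -> fd_vect -> fd_vect;
  amulA : associative amul;
  amul1 : left_id aone amul;
  amulr1 : right_id aone amul;
  amulDl : left_distributive amul +%R;
  amulDr : right_distributive amul +%R;
  amulZl : forall (a : k) x y, amul (a *: x) y = a *: amul x y;
  amulZr : forall (a : k) x y, amul x (a *: y) = a *: amul x y
}.

Arguments aone {k f}.
Arguments amul {k f} x y.
Notation "x ** y" := (amul x y) : ring_scope.

(* A left action of G: g * h acts as h followed by g.  The maps gact g with g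
   outside G are irrelevant. *)
Record galgebra (k : fieldType) (gT : finGroupType) (G : {group gT}) :=
  GAlgebra {
    galg_alg :> fdalg k;
    gact : gT -> 'End(galg_alg);
    gact1 : gact 1%g = \1%VF;
    gactM : {in G &, forall g h, gact (g * h)%g = (gact g \o gact h)%VF};
    gact_one : {in G, forall g, gact g aone = aone};
    gact_mul : {in G, forall g, {morph gact g : x y / x ** y}}
  }.

Arguments gact {k gT G} A g : rename.

Section AlgebraTheory.
Variables (k : fieldType) (B : fdalg k).
Implicit Types x y : B.

Lemma amul_suml (I : Type) (r : seq I) (P : pred I) (F : I -> B) y :
  (\sum_(i <- r | P i) F i) ** y = \sum_(i <- r | P i) F i ** y.
Proof.
have z0 : 0 ** y = 0 by rewrite -(scale0r (0 : B)) amulZl !scale0r.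
by rewrite (big_morph (fun x => x ** y) (fun u v => amulDl u v y) z0).
Qed.

Lemma amul_sumr (I : Type) (r : seq I) (P : pred I) (F : I -> B) y :
  y ** (\sum_(i <- r | P i) F i) = \sum_(i <- r | P i) y ** F i.
Proof.
have z0 : y ** 0 = 0 by rewrite -(scale0r (0 : B)) amulZr !scale0r.
by rewrite (big_morph (fun x => y ** x) (fun u v => amulDr y u v) z0).
Qed.

Lemma amulNl x y : (- x) ** y = - (x ** y).
Proof. by rewrite -!scaleN1r amulZl. Qed.

Lemma amulNr x y : x ** (- y) = - (x ** y).
Proof. by rewrite -!scaleN1r amulZr. Qed.

End AlgebraTheory.

Section Fixed.
Variables (k : fieldType) (gT : finGroupType) (G : {group gT}).
Variable A : galgebra k G.

Definition fixed (L : {set gT}) : {vspace A} :=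
  (\bigcap_(g in L) fixedSpace (gact A g))%VS.

Definition reltr (K L : {set gT}) : 'End(A) :=
  \sum_(X in lcosets K L) gact A (repr X).

Definition trace_ideal (Q : {set gT}) : {vspace A} :=
  (\sum_(R : {group gT} | R \proper Q) (reltr R Q @: fixed R))%VS.

Lemma fixedP (L : {set gT}) (x : A) :
  reflect {in L, forall g, gact A g x = x} (x \in fixed L).
Proof.
rewrite memvE; apply: (iffP subv_bigcapP) => h g gL.
  by apply/fixedSpaceP; rewrite memvE; exact: h.
by rewrite -memvE; apply/fixedSpaceP; exact: h.
Qed.

Lemma fixedS (K L : {set gT}) : K \subset L -> (fixed L <= fixed K)%VS.
Proof.
by move=> /subsetP sKL; apply/subvP=> x /fixedP fx; apply/fixedP=> g /sKL/fx.
Qed.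

Lemma gactMx g h (x : A) :
  g \in G -> h \in G -> gact A (g * h)%g x = gact A g (gact A h x).
Proof. by move=> gG hG; rewrite gactM // comp_lfunE. Qed.

Lemma fixed_one (L : {set gT}) : L \subset G -> aone \in fixed L.
Proof. by move=> /subsetP sLG; apply/fixedP=> g /sLG gG; rewrite gact_one. Qed.

Lemma fixed_mul (L : {set gT}) (x y : A) :
  L \subset G -> x \in fixed L -> y \in fixed L -> x ** y \in fixed L.
Proof.
move=> /subsetP sLG /fixedP fx /fixedP fy; apply/fixedP=> g gL.
by rewrite gact_mul ?sLG // fx // fy.
Qed.

Lemma gact_fixed (L : {group gT}) g (x : A) :
  g \in G -> L \subset G -> x \in fixed L ->
  gact A g x \in fixed (L :^ g^-1)%g.
Proof.
move=> gG /subsetP sLG /fixedP fx; apply/fixedP=> l.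
rewrite mem_conjgV => lgL.
have lG : l \in G by rewrite -(memJ_norm l (subsetP (normG G) _ gG)) sLG.
by rewrite -gactMx // conjgC gactMx ?(sLG _ lgL) // fx.
Qed.

Lemma reltrE (K L : {set gT}) (x : A) :
  reltr K L x = \sum_(X in lcosets K L) gact A (repr X) x.
Proof. by rewrite /reltr sum_lfunE. Qed.

Section Trace.
Variables (K L : {group gT}).
Hypotheses (sKL : K \subset L) (sLG : L \subset G).

Lemma gact_coset l m (x : A) : x \in fixed K -> l \in L ->
  m \in (l *: K)%g -> gact A m x = gact A l x.
Proof.
move=> /fixedP fx lL /lcosetP[u uK ->].
have uG := subsetP (subset_trans sKL sLG) _ uK.
by rewrite gactMx ?(fx u uK) // (subsetP sLG _ lL).
Qed.

Lemma lcosets_repr X : X \in lcosets K L ->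
  repr X \in L /\ X = (repr X *: K)%g.
Proof.
case/lcosetsP=> l lL ->.
have rl := mem_repr l (lcoset_refl K l); split.
  by case/lcosetP: rl => u uK ->; rewrite groupM //; exact: (subsetP sKL).
exact/esym/lcoset_eqP.
Qed.

Lemma gact_reltr g (x : A) : g \in L -> x \in fixed K ->
  gact A g (reltr K L x) = reltr K L x.
Proof.
move=> gL fx; rewrite !reltrE linear_sum /=.
have /subsetP sLG' := sLG.
rewrite [RHS](reindex_inj (@lcoset_inj _ g)) /=; apply: eq_big => X.
  apply/lcosetsP/lcosetsP=> -[l lL eX].
    by exists (g * l)%g; rewrite ?groupM // eX -lcosetM.
  exists (g^-1 * l)%g; first by rewrite groupM ?groupV.
  by rewrite lcosetM -eX lcosetK.
case/lcosets_repr=> rL eX; rewrite -gactMx ?sLG' //.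
have rgX : repr (g *: X)%g \in (g * repr X *: K)%g.
  rewrite lcosetM -eX; apply: (mem_repr (g * repr X)%g).
  by rewrite {2}eX -lcosetM lcoset_refl.
by rewrite (gact_coset fx _ rgX) // groupM.
Qed.

Lemma reltr_fixed (x : A) : x \in fixed K -> reltr K L x \in fixed L.
Proof. by move=> fx; apply/fixedP=> g gL; exact: gact_reltr. Qed.

Lemma reltr_mull (x y : A) : y \in fixed L ->
  reltr K L x ** y = reltr K L (x ** y).
Proof.
move=> /fixedP fy; rewrite !reltrE amul_suml; apply: eq_bigr => X.
by case/lcosets_repr=> rL _; rewrite gact_mul ?(subsetP sLG) // (fy _ rL).
Qed.

Lemma reltr_mulr (x y : A) : y \in fixed L ->
  y ** reltr K L x = reltr K L (y ** x).
Proof.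
move=> /fixedP fy; rewrite !reltrE amul_sumr; apply: eq_bigr => X.
by case/lcosets_repr=> rL _; rewrite gact_mul ?(subsetP sLG) // (fy _ rL).
Qed.

Lemma gact_reltrJ g (x : A) : g \in G -> x \in fixed K ->
  gact A g (reltr K L x) =
  reltr (K :^ g^-1)%g (L :^ g^-1)%g (gact A g x).
Proof.
move=> gG fx; rewrite !reltrE linear_sum /=.
have inJ : injective (fun X : {set gT} => X :^ g^-1)%g by exact: conjsg_inj.
rewrite [RHS](reindex_inj inJ) /=; apply: eq_big => X.
  apply/lcosetsP/lcosetsP=> -[l lL eX].
    exists (l ^ g^-1)%g; first by rewrite memJ_conjg.
    by rewrite eX conjsMg conjg_set1.
  exists (l ^ g)%g; first by rewrite -mem_conjgV.
  apply: inJ; rewrite eX conjsMg conjg_set1 conjgK //.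
case/lcosets_repr=> rL eX.
have : repr (X :^ g^-1)%g \in (X :^ g^-1)%g.
  apply: (mem_repr (repr X ^ g^-1)%g); rewrite memJ_conjg {2}eX lcoset_refl //.
rewrite mem_conjgV {2}eX => /lcosetP[u uK eu].
have -> : repr (X :^ g^-1)%g = (g * repr X * u * g^-1)%g.
  by rewrite -[LHS](conjgK g) eu conjgE invgK !mulgA.
have uG := subsetP (subset_trans sKL sLG) _ uK.
have rG := subsetP sLG _ rL.
rewrite -!gactMx ?groupM ?groupV // mulgKV [RHS]gactMx ?groupM //.
by move/fixedP: fx => /(_ u uK) ->.
Qed.

End Trace.

Lemma trace_idealP (Q : {set gT}) (V : {vspace A}) :
  (forall (R : {group gT}) (x : A), R \proper Q -> x \in fixed R ->
     reltr R Q x \in V) -> (trace_ideal Q <= V)%VS.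
Proof.
move=> h; apply/subv_sumP=> R pRQ; apply/subvP=> _ /memv_imgP[x fx ->].
exact: h.
Qed.

Lemma reltr_trace_ideal (Q : {set gT}) (R : {group gT}) (x : A) :
  R \proper Q -> x \in fixed R -> reltr R Q x \in trace_ideal Q.
Proof.
move=> pRQ fx; apply: (subvP (sumv_sup R pRQ (subvv _))).
exact: memv_img.
Qed.


Lemma trace_ideal_fixed (Q : {group gT}) :
  Q \subset G -> (trace_ideal Q <= fixed Q)%VS.
Proof.
move=> sQG; apply: trace_idealP => R x /proper_sub sRQ fx.
exact: reltr_fixed.
Qed.

Lemma trace_ideal_mul (Q : {group gT}) (x y : A) : Q \subset G ->
  x \in trace_ideal Q -> y \in fixed Q ->
  (x ** y \in trace_ideal Q) /\ (y ** x \in trace_ideal Q).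
Proof.
move=> sQG /memv_sumP[v vP ->] fy; rewrite amul_suml amul_sumr.
split; apply: memv_suml => R pRQ; have sRQ := proper_sub pRQ;
  have sRG := subset_trans sRQ sQG;
  have /memv_imgP[z fz ->] := vP R pRQ; have fy' := subvP (fixedS sRQ) _ fy.
- by rewrite reltr_mull // reltr_trace_ideal // fixed_mul.
- by rewrite reltr_mulr // reltr_trace_ideal // fixed_mul.
Qed.

Lemma gact_trace_ideal (Q : {group gT}) g (x : A) : Q \subset G ->
  g \in G -> x \in trace_ideal Q -> gact A g x \in trace_ideal (Q :^ g^-1)%g.
Proof.
move=> sQG gG /memv_sumP[v vP ->]; rewrite linear_sum /=.
apply: memv_suml => R pRQ; have sRQ := proper_sub pRQ.
have /memv_imgP[z fz ->] := vP R pRQ.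
rewrite gact_reltrJ //; apply: (@reltr_trace_ideal _ (R :^ g^-1)%G).
  by rewrite properJ.
by apply: gact_fixed; rewrite ?(subset_trans sRQ).
Qed.

End Fixed.

Section Brauer.
Variables (k : fieldType) (gT : finGroupType) (G : {group gT}).
Variable A : galgebra k G.
Variables (Q : {group gT}) (sQG : Q \subset G).

Local Notation J := (trace_ideal A Q).

(* The quotient space A^Q / J, realized on a linear complement of J in A^Q. *)
Definition brauer_vect : vectType k := subvs_of (fixed A Q :\: J).

Definition brauer_proj : 'Hom(A, brauer_vect) :=
  linfun (vsproj (fixed A Q :\: J) \o addv_pi1 (fixed A Q) J).

Lemma brauer_projE (x : A) :
  vsval (brauer_proj x) = addv_pi1 (fixed A Q) J x.
Proof. by rewrite lfunE /= vsprojK // memv_pi. Qed.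

Lemma brauer_projK (x : brauer_vect) : brauer_proj (vsval x) = x.
Proof.
apply: val_inj; rewrite /= brauer_projE /addv_pi1 daddv_pi_id ?subvsP //.
by rewrite capv_diff.
Qed.

Lemma brauer_val_fixed (x : brauer_vect) : vsval x \in fixed A Q.
Proof. exact: (subvP (diffvSl _ _)) (subvsP x). Qed.

Lemma brauer_proj_ker (x : A) :
  x \in fixed A Q -> (brauer_proj x == 0) = (x \in J).
Proof.
move=> fx; have xU : x \in (fixed A Q + J)%VS by rewrite (subvP (addvSl _ _)).
have e := addv_pi1_pi2 xU; apply/eqP/idP=> [p0|xJ].
  by rewrite -e -brauer_projE p0 raddf0 add0r memv_pi2.
apply: val_inj; rewrite /= brauer_projE.
by apply: (addIr (addv_pi2 (fixed A Q) J x)); rewrite e add0r addv_pi2_id.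
Qed.

Lemma brauer_proj_eq (x y : A) : x \in fixed A Q -> y \in fixed A Q ->
  x - y \in J -> brauer_proj x = brauer_proj y.
Proof.
move=> fx fy xyJ; apply/eqP; rewrite -subr_eq0 -linearB /=.
by rewrite brauer_proj_ker // memvB.
Qed.

Lemma brauer_proj_sub (x : A) :
  x \in fixed A Q -> x - vsval (brauer_proj x) \in J.
Proof.
move=> fx; rewrite -brauer_proj_ker ?memvB ?brauer_val_fixed //.
by rewrite linearB /= brauer_projK subrr.
Qed.

Definition brauer_mul (x y : brauer_vect) : brauer_vect :=
  brauer_proj (vsval x ** vsval y).

Lemma brauer_projM (x y : A) : x \in fixed A Q -> y \in fixed A Q ->
  brauer_proj (x ** y) = brauer_mul (brauer_proj x) (brauer_proj y).
Proof.
move=> fx fy; apply: brauer_proj_eq; rewrite ?fixed_mul ?brauer_val_fixed //.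
set x' := vsval _; set y' := vsval _.
have -> : x ** y - x' ** y' = (x - x') ** y + x' ** (y - y').
  by rewrite amulDl amulDr amulNl amulNr addrA subrK.
apply: memvD.
  by have [] := trace_ideal_mul sQG (brauer_proj_sub fx) fy.
by have [_] := trace_ideal_mul sQG (brauer_proj_sub fy)
  (brauer_val_fixed (brauer_proj x)).
Qed.

Lemma brauer_mulA : associative brauer_mul.
Proof.
move=> x y z; rewrite -[x]brauer_projK -[y]brauer_projK -[z]brauer_projK.
by rewrite -!brauer_projM ?fixed_mul ?brauer_val_fixed // amulA.
Qed.

Lemma brauer_mul1 : left_id (brauer_proj aone) brauer_mul.
Proof.
move=> x; rewrite -[x]brauer_projK -brauer_projM ?amul1 ?fixed_one //.
exact: brauer_val_fixed.
Qed.

Lemma brauer_mulr1 : right_id (brauer_proj aone) brauer_mul.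
Proof.
move=> x; rewrite -[x]brauer_projK -brauer_projM ?amulr1 ?fixed_one //.
exact: brauer_val_fixed.
Qed.

Lemma brauer_mulDl : left_distributive brauer_mul +%R.
Proof. by move=> x y z; rewrite /brauer_mul linearD amulDl linearD. Qed.

Lemma brauer_mulDr : right_distributive brauer_mul +%R.
Proof. by move=> x y z; rewrite /brauer_mul linearD amulDr linearD. Qed.

Lemma brauer_mulZl (a : k) x y : brauer_mul (a *: x) y = a *: brauer_mul x y.
Proof. by rewrite /brauer_mul linearZ amulZl linearZ. Qed.

Lemma brauer_mulZr (a : k) x y : brauer_mul x (a *: y) = a *: brauer_mul x y.
Proof. by rewrite /brauer_mul linearZ amulZr linearZ. Qed.

Definition brauer_fdalg : fdalg k :=
  FdAlg brauer_mulA brauer_mul1 brauer_mulr1 brauer_mulDl brauer_mulDr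
        brauer_mulZl brauer_mulZr.

Definition brauer_act (g : gT) : 'End(brauer_fdalg) :=
  (brauer_proj \o gact A g \o linfun vsval)%VF.

Lemma brauer_actE g (x : brauer_fdalg) :
  brauer_act g x = brauer_proj (gact A g (vsval x)).
Proof. by rewrite !comp_lfunE (lfunE vsval). Qed.

Lemma gact_fixedN g (x : A) : g \in 'N_G(Q)%g -> x \in fixed A Q ->
  gact A g x \in fixed A Q.
Proof.
case/setIP=> gG nQg fx; have := gact_fixed gG sQG fx.
by rewrite (normP (groupVr nQg)).
Qed.

Lemma brauer_act_proj g (x : A) : g \in 'N_G(Q)%g -> x \in fixed A Q ->
  brauer_act g (brauer_proj x) = brauer_proj (gact A g x).
Proof.
move=> gN fx; rewrite brauer_actE; apply/esym/brauer_proj_eq.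
- exact: gact_fixedN.
- exact/gact_fixedN/brauer_val_fixed.
rewrite -linearB /=; case/setIP: gN => gG nQg.
have := gact_trace_ideal sQG gG (brauer_proj_sub fx).
by rewrite (normP (groupVr nQg)).
Qed.

Lemma brauer_act1 : brauer_act 1%g = \1%VF.
Proof.
by apply/lfunP=> x; rewrite brauer_actE gact1 !id_lfunE brauer_projK.
Qed.

Lemma brauer_actM :
  {in 'N_G(Q)%g &, forall g h,
     brauer_act (g * h)%g = (brauer_act g \o brauer_act h)%VF}.
Proof.
move=> g h gN hN; apply/lfunP=> x; rewrite comp_lfunE -[x]brauer_projK.
have fx := brauer_val_fixed x; have [gG _] := setIP gN; have [hG _] := setIP hN.
by rewrite !brauer_act_proj ?groupM ?gact_fixedN // gactMx.
Qed.

Lemma brauer_act_one :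
  {in 'N_G(Q)%g, forall g, brauer_act g (@aone _ brauer_fdalg) = aone}.
Proof.
move=> g gN; have [gG _] := setIP gN.
by rewrite /= brauer_act_proj ?fixed_one // gact_one.
Qed.

Lemma brauer_act_mul :
  {in 'N_G(Q)%g, forall g, {morph brauer_act g : x y / x ** y}}.
Proof.
move=> g gN x y; rewrite -[x]brauer_projK -[y]brauer_projK /=.
have [gG _] := setIP gN.
have [fx fy] := (brauer_val_fixed x, brauer_val_fixed y).
rewrite -brauer_projM // !brauer_act_proj ?fixed_mul // gact_mul //.
by rewrite brauer_projM ?gact_fixedN.
Qed.

Definition brauer : galgebra k ('N_G(Q))%G :=
  @GAlgebra k gT ('N_G(Q))%G brauer_fdalg brauer_act
    brauer_act1 brauer_actM brauer_act_one brauer_act_mul.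

(* Only the values on A^Q matter. *)
Definition Br : 'Hom(A, brauer) := brauer_proj.

Lemma Br_surj (y : brauer) : exists2 x : A, x \in fixed A Q & Br x = y.
Proof. by exists (vsval y); [exact: brauer_val_fixed | exact: brauer_projK]. Qed.

Lemma Br_eq0 (x : A) : x \in fixed A Q -> (Br x == 0) = (x \in J).
Proof. exact: brauer_proj_ker. Qed.

Lemma Br_one : Br aone = aone.
Proof. by []. Qed.

Lemma Br_mul : {in fixed A Q &, {morph Br : x y / x ** y}}.
Proof. by move=> x y; exact: brauer_projM. Qed.

Lemma Br_act g : g \in 'N_G(Q)%g ->
  {in fixed A Q, forall x, Br (gact A g x) = gact brauer g (Br x)}.
Proof. by move=> gN x fx; rewrite /= brauer_act_proj. Qed.

End Brauer.

Definition restrict (k : fieldType) (gT : finGroupType) (G H : {group gT})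
    (sHG : H \subset G) (A : galgebra k G) : galgebra k H :=
  @GAlgebra k gT H A (gact A) (gact1 A)
    (sub_in2 (subsetP sHG) (@gactM _ _ _ A))
    (sub_in1 (subsetP sHG) (@gact_one _ _ _ A))
    (sub_in1 (subsetP sHG) (@gact_mul _ _ _ A)).

Section Transitivity.
Variables (k : fieldType) (gT : finGroupType) (G : {group gT}).
Variable A : galgebra k G.
Variables (Q S H : {group gT}).
Hypotheses (sQG : Q \subset G) (sSG : S \subset G).
Hypotheses (sHN : H \subset ('N_G(Q))%G) (sSH : S \subset H).

Local Notation AQ := (restrict sHN (brauer A sQG)).

(* The algebra homomorphism A(S) -> A(Q)(S) characterized by brauer_identE
   below; vsval x is a representative of x in A^S.  It is bijective when
   Q <= S and A is a p-permutation algebra with S a p-group, and is then the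
   usual identification of A(S) with A(Q)(S). *)
Definition brauer_ident (x : brauer A sSG) : brauer AQ sSH :=
  Br AQ sSH (Br A sQG (vsval x)).

Lemma mackey_vanish (R : {group gT}) (x : A) :
  R \subset S -> x \in fixed A R -> ~~ (Q \subset R) -> Q \subset S ->
  reltr A R S x \in trace_ideal A Q.
Proof.
move=> sRS fx nsQR sQS; rewrite reltrE.
rewrite (partition_big (fun X : {set gT} => (Q * X)%g) xpredT) //=.
apply: memv_suml => D _.
have [X0 /andP[X0S /eqP eD] | noX] :=
  pickP (fun X => (X \in lcosets R S) && (Q * X == D)%g); last first.
  by rewrite big_pred0 ?mem0v.
case/lcosetsP: X0S => s sS eX0; rewrite {X0}eX0 in eD.
have sG := subsetP sSG _ sS; have sRG := subset_trans sRS sSG.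
pose T := (Q :&: R :^ s^-1)%G; pose y := gact A s x.
have fy : y \in fixed A T.
  by apply: (subvP (fixedS A (subsetIr _ _))); exact: gact_fixed.
have nQs : s \in 'N(Q)%g.
  by have := subsetP (subset_trans sSH sHN) _ sS; rewrite inE => /andP[].
have pTQ : T \proper Q.
  rewrite properE subsetIl subsetI subxx /=; apply: contra nsQR.
  by rewrite -sub_conjg (normP nQs).
have sTQ := proper_sub pTQ.
pose h (Y : {set gT}) := (Y * (s *: R))%g.
pose h' (X : {set gT}) := (Q :&: X :* s^-1)%g.
have hE q : q \in Q -> h (q *: T)%g = ((q * s) *: R)%g.
  move=> qQ; rewrite /h lcosetM -!mulgA; congr (_ * _)%g.
  apply/eqP; rewrite eqEsubset; apply/andP; split.
    apply/subsetP=> _ /mulsgP[t _ /setIP[_ tR] /lcosetP[r rR ->] ->].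
    rewrite mem_lcoset !mulgA groupM // -mulgA.
    by move: tR; rewrite mem_conjgV conjgE.
  by apply/subsetP=> z zsR; rewrite -[z]mul1g mem_mulg.
have h'E q : q \in Q -> h' ((q * s) *: R)%g = (q *: T)%g.
  move=> qQ; apply/setP=> z; rewrite !inE mem_lcoset !inE mem_rcoset mem_lcoset.
  rewrite (groupMl _ (groupVr qQ)) mem_conjgV conjgE invgK.
  by rewrite invMg !mulgA.
have PE X : (X \in lcosets R S) && (Q * X == D)%g ->
    exists2 q, q \in Q & X = ((q * s) *: R)%g.
  case/andP=> /lcosetsP[t tS eX] /eqP eQX.
  have : t \in (Q * (s *: R))%g.
    have := mem_mulg (group1 Q) (lcoset_refl R t).
    by rewrite mul1g -eX eQX -eD.
  case/mulsgP=> q _ qQ /lcosetP[r rR ->] et; exists q => //.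
  rewrite eX et; apply/lcoset_eqP.
  by apply/lcosetP; exists r; rewrite // mulgA.
rewrite (reindex_onto h h') /=; last first.
  by move=> X /PE[q qQ ->]; rewrite h'E ?hE.
have -> : \sum_(j | ((h j \in lcosets R S) && (Q * h j == D)%g) && (h' (h j) == j))
     gact A (repr (h j)) x = reltr A T Q y.
  rewrite reltrE; apply: eq_big => j.
    apply/idP/lcosetsP=> [/andP[/andP[P1 P2] /eqP ej] | [q qQ ->]].
      have [|q qQ e] := PE (h j); first by rewrite P1.
      by exists q => //; rewrite -ej e h'E.
    rewrite hE // h'E // eqxx andbT; apply/andP; split.
      by apply/lcosetsP; exists (q * s)%g; rewrite // (groupM (subsetP sQS _ qQ)).
    by rewrite -eD lcosetM [X in X == _]mulgA rcoset_id.
  case/andP=> /andP[P1 P2] /eqP ej.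
  have [|q qQ e] := PE (h j); first by rewrite P1.
  have ejq : j = (q *: T)%g by rewrite -ej e h'E.
  have qG := subsetP sQG _ qQ.
  have r1 : repr (h j) \in ((q * s) *: R)%g.
    by rewrite e; apply: mem_repr (lcoset_refl _ _).
  have r2 : repr j \in (q *: T)%g.
    by rewrite ejq; apply: mem_repr (lcoset_refl _ _).
  rewrite (gact_coset sRS sSG fx _ r1) ?(groupM (subsetP sQS _ qQ)) //.
  by rewrite (gact_coset sTQ sQG fy qQ r2) gactMx.
exact: reltr_trace_ideal pTQ fy.
Qed.

Lemma Br_fixed (x : A) : Q \subset S -> x \in fixed A S ->
  Br A sQG x \in fixed AQ S.
Proof.
move=> sQS fx; apply/fixedP=> g gS /=.
have gN := subsetP (subset_trans sSH sHN) _ gS.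
rewrite brauer_act_proj ?(subvP (fixedS A sQS)) //.
by move/fixedP: fx => /(_ g gS) ->.
Qed.

Lemma Br_trace_ideal (x : A) : Q \subset S -> x \in trace_ideal A S ->
  Br A sQG x \in trace_ideal AQ S.
Proof.
move=> sQS /memv_sumP[v vP ->]; rewrite linear_sum /=.
apply: memv_suml => R pRS; have sRS := proper_sub pRS.
have /memv_imgP[z fz ->] := vP R pRS.
have [sQR | nsQR] := boolP (Q \subset R); last first.
  have m := mackey_vanish sRS fz nsQR sQS.
  have fm := subvP (trace_ideal_fixed A sQG) _ m.
  by move: m; rewrite -(Br_eq0 sQG) // => /eqP ->; rewrite mem0v.
have fzQ := subvP (fixedS A sQR) _ fz.
suff -> : Br A sQG (reltr A R S z) = reltr AQ R S (Br A sQG z).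
  apply: (@reltr_trace_ideal _ _ _ AQ _ _ _ pRS); apply/fixedP=> g gR /=.
  have gN := subsetP (subset_trans sSH sHN) _ (subsetP sRS _ gR).
  by rewrite brauer_act_proj //; move/fixedP: fz => /(_ g gR) ->.
rewrite !reltrE linear_sum; apply: eq_bigr => X /(lcosets_repr sRS)[rS _].
have gN := subsetP (subset_trans sSH sHN) _ rS.
exact: (Br_act sQG gN fzQ).
Qed.

Lemma brauer_identE (x : A) : Q \subset S -> x \in fixed A S ->
  brauer_ident (Br A sSG x) = Br AQ sSH (Br A sQG x).
Proof.
move=> sQS fx; apply/eqP; rewrite -subr_eq0 -!linearB /=.
have fx' := brauer_val_fixed (Br A sSG x).
rewrite Br_eq0 ?Br_fixed ?memvB //; apply: Br_trace_ideal => //.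
by rewrite -opprB memvN; exact: brauer_proj_sub.
Qed.

End Transitivity.

Section GroupAlgebra.
Variables (k : fieldType) (gT : finGroupType) (N : {group gT}).
Local Notation kN := {ffun subg_of N -> k^o}.
Implicit Types a b c : kN.

Definition grp_elt (n : subg_of N) : kN := [ffun m => (m == n)%:R].

Definition grp_mul a b : kN :=
  [ffun n => \sum_(m : subg_of N) a m * b (m^-1 * n)%g].

Lemma grp_mulA : associative grp_mul.
Proof.
move=> a b c; apply/ffunP=> n; rewrite !ffunE.
under eq_bigr => m _ do rewrite ffunE mulr_sumr.
under [RHS]eq_bigr => m _ do rewrite ffunE mulr_suml.
rewrite [RHS]exchange_big; apply: eq_bigr => l _ /=.
rewrite [RHS](reindex_inj (mulgI l)) /=; apply: eq_bigr => m _.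
by rewrite mulKg invMg !mulgA mulrA.
Qed.

Lemma grp_mul1 : left_id (grp_elt 1%g) grp_mul.
Proof.
move=> a; apply/ffunP=> n; rewrite ffunE (bigD1 1%g) //= big1 => [|m m1].
  by rewrite ffunE eqxx mul1r invg1 mul1g addr0.
by rewrite ffunE (negPf m1) mul0r.
Qed.

Lemma grp_mulr1 : right_id (grp_elt 1%g) grp_mul.
Proof.
move=> a; apply/ffunP=> n; rewrite ffunE (bigD1 n) //= big1 => [|m m1].
  by rewrite ffunE mulVg eqxx mulr1 addr0.
by rewrite ffunE -eq_mulVg1 (negPf m1) mulr0.
Qed.

Lemma grp_mulDl : left_distributive grp_mul +%R.
Proof.
move=> a b c; apply/ffunP=> n; rewrite !ffunE -big_split /=.
by apply: eq_bigr => m _; rewrite ffunE mulrDl.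
Qed.

Lemma grp_mulDr : right_distributive grp_mul +%R.
Proof.
move=> a b c; apply/ffunP=> n; rewrite !ffunE -big_split /=.
by apply: eq_bigr => m _; rewrite ffunE mulrDr.
Qed.

Lemma grp_mulZl (u : k) a b : grp_mul (u *: a) b = u *: grp_mul a b.
Proof.
apply/ffunP=> n; rewrite !ffunE scaler_sumr.
by apply: eq_bigr => m _; rewrite ffunE -scalerAl.
Qed.

Lemma grp_mulZr (u : k) a b : grp_mul a (u *: b) = u *: grp_mul a b.
Proof.
apply/ffunP=> n; rewrite !ffunE scaler_sumr.
by apply: eq_bigr => m _; rewrite ffunE -scalerAr.
Qed.

Definition grp_alg : fdalg k :=
  FdAlg grp_mulA grp_mul1 grp_mulr1 grp_mulDl grp_mulDr grp_mulZl grp_mulZr.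

Definition grp_basis (n : gT) : grp_alg := grp_elt (subg N n).

(* The action of g by conjugation, sending the group element n to g n g^-1. *)
Definition grp_conj (g : gT) (a : grp_alg) : grp_alg :=
  [ffun n : subg_of N => (a : kN) (subg N (sgval n ^ g)%g)].

End GroupAlgebra.

Arguments grp_alg k {gT} N.
Arguments grp_basis k {gT} N n.

Section BrauerPairs.
Variables (k : fieldType) (gT : finGroupType) (G : {group gT}).
Variable A : galgebra k G.

Definition p_permutation (p : nat) : Prop :=
  forall P : {group gT}, P \subset G -> (p.-group P)%g ->
  exists X : seq A,
    basis_of fullv X /\ {in P, forall g, {in X, forall x, gact A g x \in X}}.

Definition interior (N : {group gT}) (f : 'Hom(grp_alg k N, A)) : Prop :=
  [/\ f aone = aone,
      {morph f : a b / a ** b},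
      {in G, forall g a, f (grp_conj g a) = gact A g (f a)} &
      {in N, forall n x,
         gact A n x = f (grp_basis k N n) ** x ** f (grp_basis k N n^-1%g)}].

Definition primitive_idempotent (B : fdalg k) (C : B -> Prop) (e : B) : Prop :=
  [/\ C e, e ** e = e, e <> 0 &
      forall e1 e2 : B, C e1 -> C e2 -> e1 ** e1 = e1 -> e2 ** e2 = e2 ->
        e1 ** e2 = 0 -> e2 ** e1 = 0 -> e = e1 + e2 -> e1 = 0 \/ e2 = 0].

Definition primitive_fixed (L : {set gT}) (i : A) : Prop :=
  primitive_idempotent (fun x => x \in fixed A L) i.

Definition block (B : fdalg k) (e : B) : Prop :=
  primitive_idempotent (fun z => forall x : B, z ** x = x ** z) e.

Definition brauer_pair (p : nat) (c : A) (R : {group gT}) (sRG : R \subset G)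
    (e : brauer A sRG) : Prop :=
  [/\ (p.-group R)%g, block e & Br A sRG c ** e <> 0].

Definition brauer_le (R : {group gT}) (sRG : R \subset G) (e : brauer A sRG)
    (S : {group gT}) (sSG : S \subset G) (f : brauer A sSG) : Prop :=
  R \subset S /\
  forall i : A, primitive_fixed S i ->
    Br A sSG i ** f <> 0 -> Br A sRG i ** e <> 0.

Definition stabN (Q : {group gT}) (sQG : Q \subset G) (f : brauer A sQG) :
    {set gT} :=
  [set g in 'N_G(Q)%g | gact (brauer A sQG) g f == f].

Lemma stabN_sub (Q : {group gT}) (sQG : Q \subset G) (f : brauer A sQG)
    (H : {group gT}) :
  H \subset stabN f -> H \subset ('N_G(Q))%G.
Proof. by move/subset_trans; apply; apply/subsetP=> g; rewrite inE => /andP[]. Qed.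

End BrauerPairs.

(* Main.v *)
(* For x ranging over the S-fixed vectors of an S-stable basis of A, the
   x-coordinate is an S-invariant linear form, so it kills every proper
   relative trace; conversely an S-fixed vector all of whose such coordinates
   vanish is a combination of traces.  Hence Br_Q maps A^S onto A(Q)^S and
   induces A(S) = A(Q)(S).

   A primitive i in A^S then maps to zero or to a primitive idempotent of
   A(Q)^S, and f_Q is a central idempotent there, so Br_Q(i) f_Q <> 0 forces
   Br_Q(i) f_Q = Br_Q(i).  Writing z for the image of f_Q in A(Q)(S), both
   conditions of the theorem amount to z f_S <> 0; the primitivity of f_Q under
   C_N(Q) enters through Br_Q(c) f_Q = f_Q. *)
From HB Require Import structures.
Require Import Defs.
From mathcomp Require Import all_boot all_order all_algebra all_fingroup all_solvable.

Set Implicit Arguments.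
Unset Strict Implicit.
Unset Printing Implicit Defensive.

(* fingroup.action also exports a gact; this restores the one of Defs. *)
Import Defs GRing.Theory.
Local Open Scope ring_scope.

(** * Linear spans and linear dependence in a list of vectors *)

Section Span.
Variables (k : fieldType) (V : vectType k).

Lemma span_ind (P : V -> Prop) (X : seq V) :
  P 0 -> (forall a u v, P u -> P v -> P (a *: u + v)) ->
  {in X, forall u, P u} -> {in <<X>>%VS, forall v, P v}.
Proof.
move=> P0 PD; elim: X => [|u X IH] PX v.
  by rewrite span_nil memv0 => /eqP ->.
rewrite span_cons => /memv_addP[_ /vlineP[a ->] [w wX ->]].
apply: PD; first by apply: PX; rewrite mem_head.
by apply: IH => // z zX; apply: PX; rewrite inE zX orbT.
Qed.

(** Freeness is tested from the head, so it fails at a vector lying in the span of those after it.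
    For the powers of an element this expresses one power through strictly higher ones. *)
Lemma nfree_map_iota (F : nat -> V) m d :
  ~~ free [seq F j | j <- iota m d] ->
  exists n d', F n \in <<[seq F j | j <- iota n.+1 d']>>%VS.
Proof.
elim: d m => [|d IH] m /=; first by rewrite nil_free.
rewrite free_cons negb_and negbK => /orP[Fm | /IH //].
by exists m, d.
Qed.

End Span.

(** * Powers in corner algebras and primitive idempotents *)

Section FdAlgebra.
Variables (k : fieldType) (B : fdalg k).
Implicit Types x y e i : B.

Lemma amulx0 x : x ** 0 = 0.
Proof. by rewrite -(scale0r (0 : B)) amulZr !scale0r. Qed.

Lemma amul0x x : 0 ** x = 0.
Proof. by rewrite -(scale0r (0 : B)) amulZl !scale0r. Qed.

Lemma amul_linear x : linear (amul x).
Proof. by move=> a u v; rewrite amulDr amulZr. Qed.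

HB.instance Definition _ x :=
  GRing.isLinear.Build k B B *:%R (amul x) (amul_linear x).

Definition lmul x : 'End(B) := linfun (amul x).

Lemma lmulE x y : lmul x y = x ** y.
Proof. by rewrite lfunE. Qed.

(* Powers of x in the corner algebra with unit i. *)
Definition cpow i x n : B := iter n (amul x) i.

Section Corner.
Variables (i x : B).
Hypotheses (ii : i ** i = i) (ix : i ** x = x) (xi : x ** i = x).

Lemma cpow_unitl n : i ** cpow i x n = cpow i x n.
Proof. by case: n => [|n] //=; rewrite amulA ix. Qed.

Lemma cpowD m n : cpow i x m ** cpow i x n = cpow i x (m + n).
Proof. by elim: m => [|m IH] /=; rewrite ?cpow_unitl // -amulA IH. Qed.

Lemma cpow_comm y n : i ** y = y -> y ** i = y -> x ** y = y ** x ->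
  y ** cpow i x n = cpow i x n ** y.
Proof.
move=> iy yi xy; elim: n => [|n IH] /=; first by rewrite iy.
by rewrite amulA -xy -!amulA IH.
Qed.

Lemma cpow_mem (C : {vspace B}) n :
  {in C &, forall u v, u ** v \in C} -> i \in C -> x \in C ->
  cpow i x n \in C.
Proof. by move=> CM iC xC; elim: n => //= n IH; exact: CM. Qed.

(** More powers than the dimension are dependent, so some x^n is a combination of higher powers.
    Factoring out x^(n+1) leaves a polynomial y in x, which therefore stays in [C] and in the corner
    and commutes with x. *)
Lemma cpow_stable (C : {vspace B}) :
  {in C &, forall u v, u ** v \in C} -> i \in C -> x \in C ->
  exists n y, [/\ y \in C, i ** y = y, y ** i = y, x ** y = y ** x &
                  cpow i x n = cpow i x n.+1 ** y].
Proof.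
move=> CM iC xC.
have /nfree_map_iota[n [d nd]] :
    ~~ free [seq cpow i x j | j <- iota 0 (\dim {:B}).+1].
  rewrite /free size_map size_iota neq_ltn ltnS.
  by rewrite dimvS // subvf.
pose W := <<[seq cpow i x j | j <- iota 0 d]>>%VS.
have : cpow i x n \in (lmul (cpow i x n.+1) @: W)%VS.
  apply: subvP nd; apply/span_subvP=> _ /mapP[j + ->].
  rewrite mem_iota => /andP[nj jd].
  rewrite -(subnKC nj) -cpowD -lmulE memv_img // memv_span //.
  by apply/map_f; rewrite mem_iota /= add0n ltn_subLR.
case/memv_imgP=> y yW; rewrite lmulE => ny; exists n, y.
pose P y := [/\ y \in C, i ** y = y, y ** i = y & x ** y = y ** x].
suff [] : P y by [].
apply: (span_ind (P := P)) yW => [|a u v [uC iu ui xu] [vC iv vi xv]|].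
- by rewrite /P mem0v !amulx0 !amul0x.
- rewrite /P memvD ?memvZ // !(amulDr, amulDl, amulZl, amulZr).
  by rewrite iu ui iv vi xu xv.
move=> _ /mapP[j _ ->]; split; rewrite ?cpow_mem ?cpow_unitl //.
  by rewrite -[i]/(cpow i x 0) cpowD addn0.
by rewrite cpow_comm.
Qed.

End Corner.

(** [e] and [i - e] are orthogonal idempotents with sum [i]. *)
Lemma primitive_idem_sub (C : B -> Prop) i e : primitive_idempotent C i ->
  C e -> C (i - e) -> e ** e = e -> i ** e = e -> e ** i = e -> e = 0 \/ e = i.
Proof.
case=> iC ii _ prim eC ieC ee ie ei.
have [||||e0|/subr0_eq] := prim e (i - e) eC ieC ee => //.
- by rewrite amulDl !amulDr !amulNl !amulNr ii ie ei ee opprK addNr addr0.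
- by rewrite amulDr amulNr ei ee subrr.
- by rewrite amulDl amulNl ie ee subrr.
- by rewrite addrCA subrr addr0.
- by left.
- by move->; right.
Qed.

Section Primitive.
Variable C : {vspace B}.
Hypothesis CM : {in C &, forall u v, u ** v \in C}.
Local Notation primitive := (primitive_idempotent (fun z => z \in C)).

(* Fitting: if x^n = x^(n+1) y with y commuting with x, then x^m y^m is an
   idempotent of the corner for m > n, hence equal to 0 or i. *)
Lemma primitive_corner_local i x :
  primitive i -> x \in C -> i ** x = x -> x ** i = x ->
  (exists n, cpow i x n = 0) \/ (exists2 y, y \in C & x ** y = i).
Proof.
move=> prim_i xC ix xi; have [iC ii _ _] := prim_i.
have [n [y [yC iy yi xy nE]]] := cpow_stable ii ix xi CM iC xC.
have powE m : cpow i x n = cpow i x (m + n) ** cpow i y m.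
  elim: m => [|m IH]; first by rewrite -[i in _ ** i]/(cpow i x 0) cpowD ?addn0.
  rewrite addSnnS -cpowD //= -amulA [_ ** (y ** _)]amulA.
  by rewrite -[x ** _]/(cpow i x n.+1) -nE amulA cpowD.
(* The exponent n+1 leaves a factor x in front: if X Y = i, then x^n Y is a right inverse of x. *)
pose X := cpow i x n.+1; pose Y := cpow i y n.+1.
have XE : X = X ** X ** Y.
  rewrite {1}/X /= (powE n.+1) amulA -[x ** _]/(cpow i x (n.+1 + n).+1).
  by rewrite -addnS -cpowD.
have XC : X \in C by apply: cpow_mem.
have YC : Y \in C by apply: cpow_mem.
have iX : i ** X = X by apply: cpow_unitl.
have iY : i ** Y = Y by apply: cpow_unitl.
have Yi : Y ** i = Y by rewrite -[i]/(cpow i y 0) cpowD ?addn0.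
have XY : X ** Y = Y ** X.
  have Yx : Y ** x = x ** Y by rewrite [RHS]cpow_comm.
  by rewrite [RHS]cpow_comm.
have XYC : X ** Y \in C by exact: CM.
have [|||| e0 | e1] := primitive_idem_sub prim_i XYC.
- exact: memvB.
- by rewrite {1}XY -amulA [X ** (X ** Y)]amulA -XE -XY.
- by rewrite amulA iX.
- by rewrite -amulA Yi.
- by left; exists n.+1; rewrite -/X XE -amulA e0 amulx0.
right; exists (cpow i x n ** Y); first by rewrite CM ?cpow_mem.
by rewrite amulA.
Qed.

(* Otherwise split an idempotent e violating P until it is primitive. *)
Lemma idempotent_primitive_ind (P : pred B) :
  P 0 -> (forall e1 e2, P e1 -> P e2 -> P (e1 + e2)) ->
  (forall i, primitive i -> P i) ->
  forall e, e \in C -> e ** e = e -> P e.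
Proof.
move=> P0 PD Pprim e; have [m] := ubnP (\dim (lmul e @: {:B})).
elim: m e => // m IH e lt_m eC ee; apply: contraT => nPe.
suff : primitive e by move/Pprim; rewrite (negPf nPe).
split=> // [e0 | e1 e2 e1C e2C e11 e22 e12 e21 eE].
  by rewrite e0 P0 in nPe.
(* The measure is the dimension of the right ideal eB. It contains aB, and equality would put b in
   aB, whence b = ab = 0. *)
have lt_dim a b : a ** a = a -> b ** b = b -> a ** b = 0 -> b ** a = 0 ->
    e = a + b -> b <> 0 -> (\dim (lmul a @: {:B}) < m)%N.
  move=> aa bb ab0 ba0 eab b0; move: lt_m; rewrite ltnS.
  apply: leq_trans; rewrite ltnNge.
  apply/negP=> le_ea.
  have sae : (lmul a @: {:B} <= lmul e @: {:B})%VS.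
    apply/subvP=> _ /memv_imgP[y _ ->].
    have eay : e ** (a ** y) = a ** y.
      by rewrite eab amulDl !amulA aa ba0 amul0x addr0.
    by rewrite lmulE -eay -lmulE memv_img ?memvf.
  have : b \in (lmul a @: {:B})%VS.
    have /eqP -> : (lmul a @: {:B} == lmul e @: {:B})%VS by rewrite eqEdim sae.
    have <- : e ** b = b by rewrite eab amulDl ab0 bb add0r.
    by rewrite -lmulE memv_img ?memvf.
  case/memv_imgP=> y _; rewrite lmulE => bE; case: b0.
  by rewrite -ab0 bE amulA aa.
have [-> | /eqP n1] := eqVneq e1 0; first by left.
have [-> | /eqP n2] := eqVneq e2 0; first by right.
by rewrite eE PD ?IH ?(lt_dim e1 e2) ?(lt_dim e2 e1) // addrC in nPe.
Qed.

End Primitive.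
End FdAlgebra.

(** * Coordinates with respect to a basis *)

Section BasisCoordinates.
Variables (k : fieldType) (V : vectType k) (X : seq V).
Hypothesis Xbasis : basis_of fullv X.

(* Coordinate indexed by the basis vector itself; zero if x is not in X. *)
Definition bcoord (x : V) : 'Hom(V, k^o) :=
  \sum_(i < size X | X`_i == x) linfun (coord (in_tuple X) i : V -> k^o).

Lemma bcoordE x v :
  bcoord x v = \sum_(i < size X | X`_i == x) coord (in_tuple X) i v.
Proof. by rewrite sum_lfunE; apply: eq_bigr => i _; rewrite lfunE. Qed.

Lemma bcoordBZ (a : k) x u v :
  bcoord x (u - a *: v) = bcoord x u - a * bcoord x v.
Proof. by rewrite linearB linearZ. Qed.

Lemma basis_seq_uniq : uniq X.
Proof. exact: free_uniq (basis_free Xbasis). Qed.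

Lemma bcoord_nth v (i : 'I_(size X)) : bcoord X`_i v = coord (in_tuple X) i v.
Proof.
rewrite bcoordE (big_pred1 i) // => j /=.
by rewrite (nth_uniq 0) ?basis_seq_uniq.
Qed.

Lemma bcoord_expand v : v = \sum_(x <- X) bcoord x v *: x.
Proof.
rewrite (big_nth 0) big_mkord.
have vX : v \in <<in_tuple X>>%VS by rewrite (span_basis Xbasis) memvf.
by rewrite {1}(coord_span vX); apply: eq_bigr => i _; rewrite bcoord_nth.
Qed.

Lemma bcoord_basis x y : x \in X -> y \in X -> bcoord x y = (y == x)%:R.
Proof.
move=> xX yX; rewrite -[x in LHS](nth_index 0 xX) -[y in LHS](nth_index 0 yX).
have [ltx lty] : (index x X < size X)%N /\ (index y X < size X)%N.
  by rewrite !index_mem.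
rewrite (bcoord_nth _ (Ordinal ltx)).
rewrite (coord_free (Ordinal lty)) ?(basis_free Xbasis) //.
by rewrite -val_eqE /= -(nth_uniq 0 lty ltx basis_seq_uniq) !nth_index.
Qed.

Lemma bcoord_sum (P : pred V) (c : V -> k) x : x \in X ->
  bcoord x (\sum_(y <- X | P y) c y *: y) = if P x then c x else 0.
Proof.
move=> xX; rewrite linear_sum /= big_mkcond (bigD1_seq x) ?basis_seq_uniq //=.
rewrite big1_seq => [|y /andP[yx yX]].
  by rewrite linearZ /= bcoord_basis // eqxx [_ *: _]mulr1 addr0.
by rewrite linearZ /= bcoord_basis // (negPf yx) [_ *: _]mulr0 if_same.
Qed.

Lemma bcoord_eq u v : {in X, forall x, bcoord x u = bcoord x v} -> u = v.
Proof.
move=> uv; rewrite (bcoord_expand u) (bcoord_expand v).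
by apply: eq_big_seq => x xX; rewrite uv.
Qed.

End BasisCoordinates.

(** * Invariant linear forms on proper relative traces *)

Section InvariantFunctional.
Variables (k : fieldType) (p : nat) (charkp : p \in [pchar k]).
Variables (gT : finGroupType) (G : {group gT}) (A : galgebra k G).
Variable S : {group gT}.
Hypotheses (sSG : S \subset G) (pS : (p.-group S)%g).

Lemma index_proper_pchar (R : {group gT}) :
  R \proper S -> #|lcosets R S|%:R = 0 :> k.
Proof.
move=> pRS; have sRS := proper_sub pRS; apply/eqP.
rewrite -(dvdn_pcharf charkp) card_lcosets.
have := pnat_dvd (dvdn_indexg S R) pS.
case/p_natP=> n e; rewrite e; case: n e => [|n] e; last by rewrite dvdn_exp.
have eRS := index1g sRS e; by move: pRS; rewrite properE -eRS subxx.
Qed.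

(** Every summand of a trace from R has the same value under [lam], so the total is a multiple of
    the index of R in S, which is zero in k. *)
Lemma invariant_functional_trace (lam : 'Hom(A, k^o)) :
  {in S, forall g v, lam (gact A g v) = lam v} ->
  {in trace_ideal A S, forall v, lam v = 0}.
Proof.
move=> lamS v /memv_sumP[w wP ->]; rewrite linear_sum big1 //= => R pRS.
have /memv_imgP[z _ ->] := wP R pRS; rewrite reltrE linear_sum /=.
rewrite (eq_bigr (fun _ => lam z)) => [|X]; last first.
  by case/(lcosets_repr (proper_sub pRS)) => rS _; rewrite lamS.
by rewrite sumr_const -mulr_natl index_proper_pchar // mul0r.
Qed.

End InvariantFunctional.

(** * Fixed vectors and trace ideals in terms of a stable basis *)

Section PermutationBasis.
Variables (k : fieldType) (p : nat) (charkp : p \in [pchar k]).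
Variables (gT : finGroupType) (G : {group gT}) (A : galgebra k G).
Variables (S : {group gT}) (sSG : S \subset G) (pS : (p.-group S)%g).
Variable X : seq A.
Hypothesis Xbasis : basis_of fullv X.
Hypothesis Xstable : {in S, forall g, {in X, forall x, gact A g x \in X}}.

Local Notation cf := (bcoord X).

Lemma gactK g (x : A) : g \in G -> gact A g^-1%g (gact A g x) = x.
Proof. by move=> gG; rewrite -gactMx ?groupV // mulVg gact1 id_lfunE. Qed.

Lemma gactVK g (x : A) : g \in G -> gact A g (gact A g^-1%g x) = x.
Proof. by move=> gG; rewrite -gactMx ?groupV // mulgV gact1 id_lfunE. Qed.

Lemma bcoord_gact g x v : g \in S -> x \in X ->
  cf (gact A g x) (gact A g v) = cf x v.
Proof.
move=> gS xX; have gG := subsetP sSG _ gS.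
rewrite (bcoord_expand Xbasis v) !linear_sum; apply: eq_big_seq => y yX.
rewrite !linearZ /= (bcoord_basis Xbasis xX yX).
rewrite (bcoord_basis Xbasis (Xstable gS xX) (Xstable gS yX)).
by rewrite (can_eq (fun x => gactK x gG)).
Qed.

Lemma bcoord_gact_fixed g x v : g \in S -> x \in X -> x \in fixed A S ->
  cf x (gact A g v) = cf x v.
Proof.
by move=> gS xX /fixedP fx; rewrite -{1}(fx _ gS) bcoord_gact.
Qed.

Lemma bcoord_fixed_trace x v : x \in X -> x \in fixed A S ->
  v \in trace_ideal A S -> cf x v = 0.
Proof.
move=> xX fx; apply: (invariant_functional_trace charkp pS (lam := cf x)).
move=> g gS u; exact: bcoord_gact_fixed.
Qed.

Lemma bcoord_fixed_trace_eq x u v : x \in X -> x \in fixed A S ->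
  u - v \in trace_ideal A S -> cf x u = cf x v.
Proof.
move=> xX fx uvJ; apply/eqP; rewrite -subr_eq0.
by rewrite -(bcoord_fixed_trace xX fx uvJ) linearB.
Qed.

Lemma stab_group_set x : group_set [set g in S | gact A g x == x].
Proof.
apply/group_setP; split; first by rewrite inE group1 gact1 id_lfunE eqxx.
move=> g h; rewrite !inE => /andP[gS /eqP gx] /andP[hS /eqP hx].
by rewrite groupM // gactMx ?(subsetP sSG) // hx gx eqxx.
Qed.

Canonical stab_group x := Group (stab_group_set x).

Lemma stab_fixed x : x \in fixed A (stab_group x).
Proof. by apply/fixedP=> g; rewrite inE => /andP[_ /eqP]. Qed.

Lemma stab_proper x : x \notin fixed A S -> stab_group x \proper S.
Proof.
have sRS : stab_group x \subset S by apply/subsetP=> g; rewrite inE => /andP[].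
move=> nfx; rewrite properE sRS /=; apply: contra nfx => sSR.
exact: subvP (fixedS A sSR) _ (stab_fixed x).
Qed.

(** The trace from the stabilizer is the orbit sum: only the trivial coset sends x to itself, the
    others giving different basis vectors. *)
Lemma bcoord_orbit_sum x : x \in X -> x \notin fixed A S ->
  cf x (reltr A (stab_group x) S x) = 1.
Proof.
move=> xX /stab_proper/proper_sub sRS; rewrite reltrE linear_sum /=.
have RS : (stab_group x : {set gT}) \in lcosets (stab_group x) S.
  by apply/lcosetsP; exists 1%g; rewrite ?mul1g.
rewrite (bigD1 _ RS) /= big1 => [|Y /andP[YS nY]].
  have : repr (stab_group x) \in stab_group x by apply: mem_repr (group1 _).
  rewrite inE => /andP[_ /eqP ->].
  by rewrite bcoord_basis // eqxx addr0.
have [rS YE] := lcosets_repr sRS YS.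
rewrite bcoord_basis ?Xstable //; case: eqP => // rx; case/eqP: nY.
by rewrite YE lcoset_id // inE rS rx eqxx.
Qed.

(* Subtracting the multiple of the orbit sum of a basis vector x that kills
   the x-coordinate shrinks the support of a. *)
Lemma fixed_trace_ideal a : a \in fixed A S ->
  {in X, forall x, x \in fixed A S -> cf x a = 0} -> a \in trace_ideal A S.
Proof.
have [m] := ubnP (count (fun x => cf x a != 0) X).
elim: m a => // m IH a lt_m fa a0.
have [/hasP[x xX cx0] | /hasPn all0] := boolP (has (fun x => cf x a != 0) X).
  have nfx : x \notin fixed A S by apply: contra cx0 => fx; rewrite a0.
  pose R := stab_group x; have pRS : R \proper S := stab_proper nfx.
  pose t := reltr A R S x.
  have tJ : t \in trace_ideal A S := reltr_trace_ideal pRS (stab_fixed x).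
  have ft : t \in fixed A S := subvP (trace_ideal_fixed A sSG) _ tJ.
  rewrite -[a](subrK (cf x a *: t)) memvD ?memvZ //.
  apply: IH => [||y yX fy]; last 2 first.
  - by rewrite memvB ?memvZ.
  - by rewrite bcoordBZ a0 // (bcoord_fixed_trace yX fy tJ) mulr0 subr0.
  have cfx : cf x (a - cf x a *: t) = 0.
    by rewrite bcoordBZ bcoord_orbit_sum // mulr1 subrr.
  (* No new support appears: a basis vector y occurring in [t] lies in the orbit of x, and
     invariance of [a] gives it the same nonzero coordinate as x. *)
  have sub y : y \in X -> cf y (a - cf x a *: t) != 0 -> cf y a != 0.
    move=> yX; rewrite bcoordBZ.
    have [-> | ] := eqVneq (cf y t) 0; first by rewrite mulr0 subr0.
    move=> cyt0 _; apply: contra cyt0 => /eqP cya; rewrite /t reltrE linear_sum.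
    rewrite big1 //= => Y /(lcosets_repr (proper_sub pRS))[rS _].
    rewrite bcoord_basis ?Xstable //; case: eqP => // rx; case/eqP: cx0.
    have ga : gact A (repr Y) a = a by move/fixedP: fa => /(_ _ rS).
    by rewrite -(bcoord_gact a rS xX) rx ga.
  move: lt_m; rewrite ltnS; apply: leq_trans; rewrite -!size_filter.
  rewrite -[_.+1]/(size (x :: [seq y <- X | cf y (a - cf x a *: t) != 0])).
  apply: uniq_leq_size => [|y].
    by rewrite /= mem_filter cfx eqxx filter_uniq ?(basis_seq_uniq Xbasis).
  rewrite inE !mem_filter => /predU1P[-> | /andP[cy yX]]; first by rewrite cx0.
  by rewrite sub.
have -> : a = 0; last exact: mem0v.
apply: (bcoord_eq Xbasis) => x xX; rewrite linear0; apply/eqP.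
by have := all0 x xX; rewrite negbK.
Qed.

End PermutationBasis.

(** * The isomorphism between A(S) and A(Q)(S) *)

Section Identification.
Variables (k : fieldType) (p : nat) (charkp : p \in [pchar k]).
Variables (gT : finGroupType) (G : {group gT}) (A : galgebra k G).
Hypothesis Aperm : p_permutation A p.
Variables (Q S H : {group gT}).
Hypotheses (sQG : Q \subset G) (sSG : S \subset G).
Hypotheses (sHN : H \subset ('N_G(Q))%G) (sSH : S \subset H).
Hypotheses (sQS : Q \subset S) (pS : (p.-group S)%g).

Local Notation AQ := (restrict sHN (brauer A sQG)).
Local Notation ident := (@brauer_ident _ _ _ A Q S H sQG sSG sHN sSH).

Let pQ : (p.-group Q)%g := pgroupS sQS pS.

Lemma Br_trace_ideal_inv a : a \in fixed A S ->
  Br A sQG a \in trace_ideal AQ S -> a \in trace_ideal A S.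
Proof.
move=> fa aJ; have [X [Xb Xst]] := Aperm sSG pS.
apply: (fixed_trace_ideal charkp sSG pS Xb Xst fa) => x xX fx.
have XstQ := sub_in1 (subsetP sQS) Xst.
have fxQ := subvP (fixedS A sQS) _ fx; have faQ := subvP (fixedS A sQS) _ fa.
(* The x-coordinate kills the trace ideal of Q, so its value on the chosen representatives is a
   well-defined form on A(Q). It is S-invariant because x is S-fixed, hence vanishes on traces
   there. *)
pose lam : 'Hom(AQ, k^o) := (bcoord X x \o linfun vsval)%VF.
have lamBr v : v \in fixed A Q -> lam (Br A sQG v) = bcoord X x v.
  move=> fv; rewrite comp_lfunE lfunE; apply/esym.
  apply: (bcoord_fixed_trace_eq charkp sQG pQ Xb XstQ) => //.
  exact: brauer_proj_sub.
rewrite -lamBr //; apply: (invariant_functional_trace charkp pS _ aJ) => g gS b.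
have gN := subsetP (subset_trans sSH sHN) _ gS.
have [v fv <-] := Br_surj b.
rewrite /= brauer_act_proj // !lamBr ?gact_fixedN //.
exact: (bcoord_gact_fixed sSG Xb Xst).
Qed.

(** Keep only the Q-fixed basis vectors in a lift of b. Their coordinates are determined by the
    image in A(Q), and S, normalizing Q, permutes both them and the remaining basis vectors; so this
    truncated lift is S-fixed. *)
Lemma Br_fixed_surj b : b \in fixed AQ S ->
  exists2 a, a \in fixed A S & Br A sQG a = b.
Proof.
move=> fb; have [X [Xb Xst]] := Aperm sSG pS.
have XstQ := sub_in1 (subsetP sQS) Xst.
have [v fv vb] := Br_surj b.
pose a := \sum_(x <- X | x \in fixed A Q) bcoord X x v *: x.
have fa : a \in fixed A Q by apply: memv_suml => x fx; rewrite memvZ.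
have aE x : x \in X ->
    bcoord X x a = if x \in fixed A Q then bcoord X x v else 0.
  exact: (bcoord_sum Xb).
have ab : Br A sQG a = b.
  rewrite -vb; apply: brauer_proj_eq => //.
  apply: (fixed_trace_ideal charkp sQG pQ Xb XstQ); first exact: memvB.
  by move=> x xX fx; rewrite linearB /= aE // fx subrr.
exists a => //; apply/fixedP=> g gS; have gG := subsetP sSG _ gS.
have gN := subsetP (subset_trans sSH sHN) _ gS.
apply: (bcoord_eq Xb) => x xX.
have [fx | nfx] := boolP (x \in fixed A Q).
  apply: (bcoord_fixed_trace_eq charkp sQG pQ Xb XstQ) => //.
  have gab : Br A sQG (gact A g a) = Br A sQG a.
    apply: etrans (esym (brauer_act_proj sQG gN fa)) _.
    by move: fb; rewrite -ab => /fixedP/(_ g gS).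
  rewrite -(Br_eq0 sQG) ?memvB ?gact_fixedN //; apply/eqP.
  by apply: etrans (linearB _ _ _) _; apply/eqP; rewrite subr_eq0; apply/eqP.
have y_nfx : gact A g^-1%g x \notin fixed A Q.
  apply: contra nfx => fy; rewrite -(gactVK x gG); exact: gact_fixedN.
have yX : gact A g^-1%g x \in X by apply: Xst; rewrite ?groupV.
rewrite -{1}(gactVK x gG) (bcoord_gact sSG Xb Xst) // !aE //.
by rewrite (negPf nfx) (negPf y_nfx).
Qed.

Lemma brauer_ident_additive : {morph ident : x y / x + y}.
Proof. by move=> x y; rewrite /brauer_ident !linearD. Qed.

Lemma brauer_ident_mul : {morph ident : x y / x ** y}.
Proof.
move=> x y; have [a fa <-] := Br_surj x; have [b fb <-] := Br_surj y.
have [faQ fbQ] := (subvP (fixedS A sQS) _ fa, subvP (fixedS A sQS) _ fb).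
rewrite -(Br_mul sSG fa fb) !brauer_identE ?fixed_mul // (Br_mul sQG faQ fbQ).
exact: (Br_mul sSH (Br_fixed sQG sHN sSH sQS fa) (Br_fixed sQG sHN sSH sQS fb)).
Qed.

Lemma brauer_ident_inj : injective ident.
Proof.
move=> x y; have [a fa <-] := Br_surj x; have [b fb <-] := Br_surj y.
rewrite !brauer_identE // => /eqP; rewrite -subr_eq0 -!linearB /=.
have fab : a - b \in fixed A S by rewrite memvB.
rewrite Br_eq0 ?Br_fixed // => abJ.
apply/eqP; rewrite -subr_eq0 -linearB Br_eq0 //.
exact: Br_trace_ideal_inv.
Qed.

Lemma brauer_ident_surj y : exists x, ident x = y.
Proof.
have [b fb <-] := Br_surj y; have [a fa <-] := Br_fixed_surj fb.
by exists (Br A sSG a); rewrite brauer_identE.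
Qed.

End Identification.

(** * Transport of blocks, and images of primitive idempotents *)

Section BlockIso.
Variables (k : fieldType) (B C : fdalg k) (phi : B -> C).
Hypotheses (phiD : {morph phi : x y / x + y}).
Hypotheses (phiM : {morph phi : x y / x ** y}).
Hypotheses (phi_inj : injective phi) (phi_surj : forall y, exists x, phi x = y).

Lemma block_iso e : block e -> block (phi e).
Proof.
have phi0 : phi 0 = 0 by apply: (addrI (phi 0)); rewrite -phiD !addr0.
case=> eZ ee e0 eprim; split=> [y | | | y1 y2].
- by have [x <-] := phi_surj y; rewrite -!phiM eZ.
- by rewrite -phiM ee.
- by rewrite -phi0 => /phi_inj.
have [[x1 <-] [x2 <-]] := (phi_surj y1, phi_surj y2).
rewrite -!phiM -phiD => z1 z2 /phi_inj i1 /phi_inj i2.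
rewrite -phi0 => /phi_inj o12 /phi_inj o21 /phi_inj eE.
have cen x : (forall y, phi x ** y = y ** phi x) -> forall y, x ** y = y ** x.
  by move=> zx y; apply: phi_inj; rewrite !phiM.
by case: (eprim x1 x2) => // [||->|->]; [exact: cen | exact: cen | left | right].
Qed.

End BlockIso.

(* The element i w i of the local corner algebra at i is not nilpotent, hence
   invertible there; so psi i lies in the ideal generated by psi w. *)
Lemma primitive_image_absorbs (k : fieldType) (B C : fdalg k) (psi : B -> C)
    (U : {vspace B}) (i w : B) :
  psi 0 = 0 -> {in U &, forall x y, x ** y \in U} ->
  {in U &, {morph psi : x y / x ** y}} ->
  primitive_idempotent (fun z => z \in U) i -> w \in U ->
  psi w ** psi w = psi w -> psi i ** psi w = psi w ** psi i ->
  psi i ** psi w <> 0 -> psi i ** psi w = psi i.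
Proof.
move=> psi0 UM psiM prim_i wU ww iw nz; have [iU ii _ _] := prim_i.
pose x := i ** w ** i; have iwU : i ** w \in U by exact: UM.
have xU : x \in U by exact: UM.
have psi_i : psi i ** psi i = psi i by rewrite -psiM ?ii.
have psi_x : psi x = psi i ** psi w.
  by rewrite !psiM // -amulA -iw amulA psi_i.
have gg : psi i ** psi w ** (psi i ** psi w) = psi i ** psi w.
  by rewrite -amulA [psi w ** (_ ** _)]amulA -iw -amulA ww amulA psi_i.
have [||[n xn0] | [y yU xy]] := primitive_corner_local UM prim_i xU.
- by rewrite !amulA ii.
- by rewrite -amulA ii.
(* [psi x] is the idempotent [psi i ** psi w], so a vanishing power of x would make it zero. *)
- have powE m : cpow i x m \in U /\ psi (cpow i x m) ** psi w = psi i ** psi w.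
    elim: m => [|m [mU IH]]; first by [].
    by split; rewrite /= ?UM // psiM // -amulA IH psi_x gg.
  by case: nz; have [_ <-] := powE n; rewrite xn0 psi0 amul0x.
rewrite iw -{1}xy psiM // psi_x amulA amulA -iw -[_ ** psi w ** psi w]amulA ww.
by rewrite -psi_x -psiM // xy.
Qed.

(** * Equivalence of the two Brauer pair conditions *)

Theorem proposition3p1 (k : fieldType) (p : nat) (charkp : p \in [pchar k])
    (gT : finGroupType) (G N : {group gT}) (nNG : (N <| G)%g)
    (p_dvd_N : (p %| #|N|)%N)
    (A : galgebra k G) (A_perm : p_permutation A p)
    (f : 'Hom(grp_alg k N, A)) (f_int : interior f)
    (c : A) (c_prim : primitive_fixed G c)
    (Q : {group gT}) (sQG : Q \subset G) (fQ : brauer A sQG)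
    (QfQ_pair : brauer_pair p c fQ)
    (fQ_prim : primitive_fixed (A := brauer A sQG) 'C_N(Q)%g fQ)
    (H : {group gT}) (sCH : 'C_N(Q)%g \subset H) (sHN : H \subset stabN fQ)
    (S : {group gT}) (pS : (p.-group S)%g) (sSG : S \subset G)
    (sQS : Q \subset S) (sSH : S \subset H)
    (fS : brauer A sSG) (fS_block : block fS) :
  (brauer_pair p c fS /\ brauer_le fQ fS) <->
  brauer_pair (A := restrict (stabN_sub sHN) (brauer A sQG)) p fQ
    (brauer_ident sQG (stabN_sub sHN) sSH fS).
Proof.
have [_ [fQ_cen fQ_idem _ _] Q_nz] := QfQ_pair.
set sHN' := stabN_sub sHN; set AQ := restrict sHN' (brauer A sQG).
pose BQ : A -> AQ := Br A sQG; pose BS := Br A sSG; pose BQS := Br AQ sSH.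
pose phi := @brauer_ident _ _ _ A Q S H sQG sSG sHN' sSH.
rewrite -/(phi fS).
have phi_add : {morph phi : x y / x + y} by exact: brauer_ident_additive.
have phi_mul : {morph phi : x y / x ** y} by exact: brauer_ident_mul.
have phi_inj : injective phi by exact: (brauer_ident_inj charkp A_perm).
have phi_surj y : exists x, phi x = y by exact: (brauer_ident_surj charkp A_perm).
have phi0 : phi 0 = 0 by apply: (addrI (phi 0)); rewrite -phi_add !addr0.
have phi_Br a : a \in fixed A S -> phi (BS a) = BQS (BQ a).
  exact: brauer_identE.
have BQ_fixed a : a \in fixed A S -> BQ a \in fixed AQ S by exact: Br_fixed.
have BQ_mul : {in fixed A S &, {morph BQ : x y / x ** y}}.
  move=> a b /(subvP (fixedS A sQS)) fa /(subvP (fixedS A sQS)) fb.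
  exact: Br_mul.
have BQS_mul : {in fixed AQ S &, {morph BQS : x y / x ** y}} by exact: Br_mul.
have fixedSM : {in fixed A S &, forall x y, x ** y \in fixed A S}.
  by move=> x y; exact: fixed_mul.
have fQ_fixed : (fQ : AQ) \in fixed AQ S.
  apply/fixedP=> g /(subsetP sSH)/(subsetP sHN).
  by rewrite inE => /andP[_ /eqP].
pose z := BQS fQ.
(* Centrality passes down from A(Q) because every y lifts to an S-fixed element of A(Q). *)
have z_cen y : z ** y = y ** z.
  by have [b fb <-] := Br_surj y; rewrite -!BQS_mul // [fQ ** _]fQ_cen.
have zz : z ** z = z by rewrite -BQS_mul // [fQ ** _]fQ_idem.
have [phi_cen phi_idem _ _] :=
  block_iso phi_add phi_mul phi_inj phi_surj fS_block.
split=> [[_ [_ le_QS]] | [_ phi_block z_nz]].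
  split=> //; first exact: block_iso.
  rewrite -[Br _ _ _]/z => z0.
  have BS0 i : i \in fixed A S -> BQS (BQ i) ** z = BQS (BQ i) ->
      BS i ** fS = 0.
    move=> fi iz; apply: phi_inj; rewrite phi_mul phi_Br // -iz -amulA z0 phi0.
    exact: amulx0.
  (* Assuming z = 0, [P] is shown for all primitive idempotents of A^S, hence for the unit, which
     forces [fS] = 0. *)
  pose P (e : A) := BS e ** fS == 0.
  have P_prim i : primitive_idempotent (fun x => x \in fixed A S) i -> P i.
    move=> prim_i; have [fi _ _ _] := prim_i.
    apply: contraT => /eqP/[dup] nz0 /(le_QS i prim_i) nz.
    case: nz0; apply: BS0 => //.
    (* Lifting [fQ] to A^S lets the absorption argument apply to [BQ] on A^S: the product of [BQ i]
       with [fQ], being nonzero, equals [BQ i]. *)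
    have [w fw wE] := Br_fixed_surj charkp A_perm sSG sSH sQS pS fQ_fixed.
    rewrite -BQS_mul ?BQ_fixed //; congr (BQS _).
    rewrite -wE.
    apply: (primitive_image_absorbs (U := fixed A S) (psi := BQ)) => //.
    - exact: linear0.
    - by rewrite [BQ w]wE; exact: fQ_idem.
    - by rewrite [BQ w]wE; exact/esym/fQ_cen.
    - by rewrite [BQ w]wE.
  have /eqP : P aone.
    apply: (idempotent_primitive_ind (P := P) _ _ P_prim).
    - by rewrite /P [BS 0]linear0 amul0x.
    - move=> e1 e2 /eqP P1 /eqP P2.
      by rewrite /P [BS (e1 + e2)]linearD amulDl P1 P2 addr0.
    - exact: fixed_one.
    - exact: amul1.
  rewrite [BS aone]Br_one amul1 => fS0.
  by case: fS_block => _ _ /(_ fS0).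
(* A central idempotent times a block is zero or the block, and zero is excluded by the hypothesis
   on z. *)
have z_phi : z ** phi fS = phi fS.
  have zphi_cen x : z ** phi fS ** x = x ** (z ** phi fS).
    by rewrite -amulA phi_cen z_cen -amulA -z_cen.
  have [|||||/z_nz|] // := primitive_idem_sub phi_block (e := z ** phi fS).
  - by move=> x; rewrite amulDl amulDr amulNl amulNr phi_cen zphi_cen.
  - rewrite -amulA [phi fS ** (_ ** _)]amulA phi_cen.
    by rewrite -[_ ** _ ** phi fS]amulA phi_idem amulA zz.
  - by rewrite amulA phi_cen -amulA phi_idem.
  - by rewrite -amulA phi_idem.
(* Since z absorbs into [phi fS], the element [phi (BS a ** fS)] has the image of [BQ a ** fQ] as a
   factor. This gives the order relation. *)
have fixed_nz a : a \in fixed A S -> BS a ** fS <> 0 -> BQ a ** fQ <> 0.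
  move=> fa nz afQ0; case: nz; apply: phi_inj.
  have az0 : BQS (BQ a) ** z = 0.
    rewrite -(linear0 BQS) -[RHS](congr1 BQS afQ0).
    exact/esym/(BQS_mul _ _ (BQ_fixed _ fa) fQ_fixed).
  by rewrite phi_mul phi_Br // -z_phi amulA az0 amul0x phi0.
split; last by split=> // i [fi _ _ _]; exact: fixed_nz.
have [fc cc _ _] := c_prim.
(* The product is a nonzero idempotent below [fQ] fixed by ['C_N(Q)], where [fQ] is primitive. *)
have cfQ : Br A sQG c ** fQ = fQ.
  have H_sub : 'C_N(Q)%g \subset 'N_G(Q)%g := subset_trans sCH sHN'.
  have fcC : Br A sQG c \in fixed (brauer A sQG) 'C_N(Q)%g.
    apply/fixedP=> g /(subsetP H_sub) gN; have [gG _] := setIP gN.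
    apply: etrans (brauer_act_proj sQG gN _) _.
      exact: subvP (fixedS A sQG) _ fc.
    by move/fixedP: fc => /(_ g gG) ->.
  have fcQ : c \in fixed A Q := subvP (fixedS A sQG) _ fc.
  have ccQ : Br A sQG c ** Br A sQG c = Br A sQG c by rewrite -Br_mul ?cc.
  have [fQC _ _ _] := fQ_prim.
  have ceC : Br A sQG c ** fQ \in fixed (brauer A sQG) 'C_N(Q)%g.
    exact: fixed_mul.
  have [||||/Q_nz|] // := primitive_idem_sub fQ_prim ceC.
  - exact: memvB.
  - by rewrite -amulA [fQ ** (_ ** _)]amulA fQ_cen -amulA fQ_idem amulA ccQ.
  - by rewrite fQ_cen -amulA fQ_idem.
  - by rewrite -amulA fQ_idem.
split=> // cfS0; case: z_nz; rewrite -[Br _ _ _]/z.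
have fcS : c \in fixed A S := subvP (fixedS A sSG) _ fc.
(* Applying [BQS] to [cfQ] shows that the image of c fixes z, so [BS c ** fS] = 0 would give z
   [phi fS] = 0. *)
have cz : BQS (BQ c) ** z = z.
  apply: etrans (esym (BQS_mul _ _ (BQ_fixed _ fcS) fQ_fixed)) _.
  exact: (congr1 BQS cfQ).
by rewrite -cz -amulA z_phi -phi_Br // -phi_mul cfS0 phi0.
Qed.
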